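(* Let $m\ge1$ and let $\epsilon=(\epsilon_1,\dots,\epsilon_s)$ be a circular sequence of integers, not all zero. If $\epsilon'$ is the circular sequence obtained from $\epsilon$ by removing all zero entries, then $c(\Gamma^m_\epsilon)=c(\Gamma^m_{\epsilon'})$ and $\ell(\Gamma^m_\epsilon)=\ell(\Gamma^m_{\epsilon'})$.
   Context: Digraph $\Gamma^m_\epsilon$ of a circular integer sequence $\epsilon=(\epsilon_1,\dots,\epsilon_s)$ (indices mod $s$): vertices $x_{i,t}$, $0\le i\le m-1$, $t\in\{1,\dots,s\}$, some ''marked zero''. If $s=1$: if $\epsilon_1\ne0$ all vertices are marked zero and there are no edges; if $\epsilon_1=0$ nothing is marked and each $x_{i,1}$ carries a loop of weight $0$. If $s\ge2$: for each $t$ let $A_t=\max(\epsilon_t,0)$, $B_t=\max(-\epsilon_{t+1},0)$; for each $j\in\{0,\dots,m-1\}$: if $j\ge\max(A_t,B_t)$ add an edge from $x_{j-A_t,t}$ to $x_{j-B_t,t+1}$ of weight $A_t-B_t$; if $A_t\le j<B_t$ mark $x_{j-A_t,t}$ zero; if $B_t\le j<A_t$ mark $x_{j-B_t,t+1}$ zero. Each connected component is a directed path (linear digraph, possibly a single vertex) or a directed cycle (circular digraph); a linear digraph with no vertex marked zero is a free linear digraph. $\ell(\cdot)$ = number of free linear digraphs, $c(\cdot)$ = number of circular digraphs. *)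

(* Defs.v *)
From mathcomp Require Import all_boot all_order all_algebra.

Set Implicit Arguments.
Unset Strict Implicit.
Unset Printing Implicit Defensive.

Import Order.TTheory GRing.Theory Num.Theory.
Local Open Scope ring_scope.

(* [weight x y] is meaningful only when [edge x y] holds. A binary relation
   suffices for the edges: the digraphs below have no parallel edges. *)
Record marked_digraph := MarkedDigraph {
  vertex : finType;
  edge : rel vertex;
  weight : vertex -> vertex -> int;
  marked_zero : pred vertex
}.

Section Components.

Variable G : marked_digraph.

Definition adjacent : rel (vertex G) := [rel x y | edge x y || edge y x].

Definition components : {set {set vertex G}} :=
  equivalence_partition (connect adjacent) [set: vertex G].

(* Directed path v_0 -> v_1 -> ... -> v_k on C, with no other edge; k = 0
   gives a single vertex without loop. *)
Definition is_linear (C : {set vertex G}) : bool :=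
  [exists v : #|C|.-tuple (vertex G),
    [&& uniq v, [set x in v] == C &
      [forall x in C, forall y in C,
        edge x y == (index y v == (index x v).+1)]]].

(* Directed cycle v_0 -> ... -> v_k -> v_0 on C, with no other edge; k = 0
   gives a single vertex with a loop. *)
Definition is_circular (C : {set vertex G}) : bool :=
  [exists v : #|C|.-tuple (vertex G),
    [&& uniq v, [set x in v] == C &
      [forall x in C, forall y in C, edge x y == (y == next v x)]]].

Definition is_free_linear (C : {set vertex G}) : bool :=
  is_linear C && [forall x in C, ~~ marked_zero x].

Definition num_free_linear : nat :=
  #|[set C in components | is_free_linear C]|.

Definition num_circular : nat :=
  #|[set C in components | is_circular C]|.

End Components.

(* A circular sequence is given by a list; its positions are numbered from 0,
   and [ordS] is the successor modulo its length. The vertex x_{i,t} is the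
   pair (i, t). *)
Section Gamma.

Variables (m : nat) (eps : seq int).

Let V := ('I_m * 'I_(size eps))%type.

Definition gammaA (t : 'I_(size eps)) : int := Num.max eps`_t 0.
Definition gammaB (t : 'I_(size eps)) : int := Num.max (- eps`_(ordS t)) 0.

Definition gamma_edge : rel V := fun x y =>
  if size eps == 1%N then (eps`_0 == 0) && (x == y) else
  (y.2 == ordS x.2) &&
  [exists j : 'I_m,
    [&& Num.max (gammaA x.2) (gammaB x.2) <= j%:Z,
        x.1%:Z == j%:Z - gammaA x.2 & y.1%:Z == j%:Z - gammaB x.2]].

Definition gamma_weight (x _ : V) : int :=
  if size eps == 1%N then 0 else gammaA x.2 - gammaB x.2.

Definition gamma_zero : pred V := fun x =>
  if size eps == 1%N then eps`_0 != 0 else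
  [exists t : 'I_(size eps), exists j : 'I_m,
    [&& gammaA t <= j%:Z, j%:Z < gammaB t, x.2 == t
      & x.1%:Z == j%:Z - gammaA t]
    || [&& gammaB t <= j%:Z, j%:Z < gammaA t, x.2 == ordS t
         & x.1%:Z == j%:Z - gammaB t]].

Definition Gamma : marked_digraph :=
  @MarkedDigraph V gamma_edge gamma_weight gamma_zero.

End Gamma.

(* Main.v *)
(* In- and out-degrees are at most one, so a component is circular iff all its
   vertices have an outgoing edge, and linear otherwise. A zero entry between
   positions t-1 and t+1 has gammaA = 0, and its predecessor has gammaB = 0;
   hence a vertex in its column is either interior to a path
   x_{j-A,t-1} -> x_{j,t} -> x_{j-B,t+1}, or a marked end next to a vertex that
   becomes marked once the zero is removed, or an isolated marked vertex.
   Suppressing the column thus contracts components without changing which are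
   circular or free. Zeros are removed one at a time under the rule for s >= 2;
   if a single entry a != 0 remains, that rule and the special rule for s = 1
   both give no circular and no free component. *)

Require Import Defs.
From mathcomp Require Import all_boot all_order all_algebra.
From mathcomp Require Import zify.
Import Order.TTheory GRing.Theory Num.Theory.
Local Open Scope ring_scope.

(** * Components of digraphs whose in- and out-degrees are at most one *)

Definition component {G : marked_digraph} (x : vertex G) : {set vertex G} :=
  [set y | connect (@adjacent G) x y].

Definition has_out {G : marked_digraph} (x : vertex G) : bool :=
  [exists y, edge x y].

Definition edge_functional (G : marked_digraph) : Prop :=
  forall x y z : vertex G, edge x y -> edge x z -> y = z.

Definition edge_injective (G : marked_digraph) : Prop :=
  forall x y z : vertex G, edge x z -> edge y z -> x = y.

Lemma connect_adjacent_sym (G : marked_digraph) : connect_sym (@adjacent G).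
Proof. by apply: sym_connect_sym => x y; rewrite /adjacent /= orbC. Qed.

Lemma components_imset (G : marked_digraph) :
  components G = [set component x | x in [set: vertex G]].
Proof.
rewrite /components /equivalence_partition.
by apply: eq_imset => x; apply/setP => y; rewrite !inE.
Qed.

Lemma mem_component {G : marked_digraph} (x : vertex G) : x \in component x.
Proof. by rewrite inE connect0. Qed.

Lemma component_eq {G : marked_digraph} (x y : vertex G) :
  y \in component x -> component y = component x.
Proof.
rewrite inE => xy; apply/setP => z; rewrite !inE.
by rewrite (same_connect (@connect_adjacent_sym G) xy).
Qed.

Lemma component_out {G : marked_digraph} {x y z : vertex G} :
  y \in component x -> edge y z -> z \in component x.
Proof.
rewrite !inE => xy yz; apply: connect_trans xy (connect1 _).
by rewrite /adjacent /= yz.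
Qed.

Lemma component_in {G : marked_digraph} {x y z : vertex G} :
  z \in component x -> edge y z -> y \in component x.
Proof.
rewrite !inE => xz yz; apply: connect_trans xz (connect1 _).
by rewrite /adjacent /= yz orbT.
Qed.

(** Induction over a component: the equality [D y = D z] carries the property along edges in both
    directions, hence along [adjacent]. *)
Lemma component_sub {G : marked_digraph} (x : vertex G) (D : pred (vertex G)) :
  D x -> (forall y z, edge y z -> D y = D z) ->
  forall y, y \in component x -> D y.
Proof.
move=> Dx DE y; rewrite inE => xy.
have cl : closed (@adjacent G) D.
  by move=> u v /= /orP[] uv; rewrite /in_mem /= (DE _ _ uv).
by have := closed_connect cl xy; rewrite /in_mem /= => <-.
Qed.

(** If every vertex has a successor, the successor map is injective on the component by [injG], so
    the orbit of [x] is a cycle. Being closed under edges in both directions, the orbit fills the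
    component. *)
Lemma is_circular_component (G : marked_digraph) (x : vertex G) :
  edge_functional G -> edge_injective G ->
  is_circular (component x) = [forall y in component x, has_out y].
Proof.
move=> funG injG; apply/existsP/forall_inP => [[v /and3P[_ /eqP/setP Ev]]|out].
  have memE y : (y \in component x) = (y \in tval v) by rewrite -Ev inE.
  move/forall_inP=> edgeE y Cy; apply/existsP; exists (next v y).
  have Cn : next v y \in component x by rewrite memE mem_next -memE.
  by rewrite (eqP (forall_inP (edgeE y Cy) _ Cn)).
(* Every vertex of the component has a successor, so the default [y] can be returned only outside
   it. *)
pose f (y : vertex G) := odflt y [pick z | edge y z].
have fE y : y \in component x -> edge y (f y).
  move=> /out/existsP[z yz]; rewrite /f; case: pickP => //= nz.
  by rewrite nz in yz.
have orbC y : y \in orbit f x -> y \in component x.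
  move/trajectP => [n _ ->]; elim: n => [|n IH]; first exact: mem_component.
  exact: component_out IH (fE _ IH).
have fcyc : fcycle f (orbit f x).
  (* Injectivity of [f] on the orbit is equivalent to the orbit being an [f]-cycle. *)
  apply/(orbitPcycle 0%N 5%N) => y z /orbC Cy /orbC Cz fyz.
  by apply: (injG _ _ _ (fE _ Cy)); rewrite fyz fE.
have mem_f y : y \in orbit f x -> f y \in orbit f x.
  by move=> oy; rewrite -(nextE fcyc oy) mem_next.
have Eorb : [set y in orbit f x] = component x.
  apply/setP => y; rewrite inE; apply/idP/idP => [/orbC //|].
  apply: (@component_sub G x (fun y => y \in orbit f x)).
    by rewrite -fconnect_orbit connect0.
  move=> {}y z yz; apply/idP/idP => [oy|oz].
    by rewrite (funG _ _ _ yz (fE _ (orbC _ oy))) mem_f.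
  (* The cyclic predecessor of [z] in the orbit also has an edge to [z], so [injG] identifies it
     with [y]. *)
  have op : prev (orbit f x) z \in orbit f x by rewrite mem_prev.
  have := fE _ (orbC _ op).
  by rewrite -(nextE fcyc op) next_prev ?orbit_uniq // => /(injG _ _ _ yz) ->.
have sz : size (orbit f x) == #|component x|.
  by rewrite -Eorb cardsE (card_uniqP (orbit_uniq f x)).
exists (Tuple sz); rewrite /= orbit_uniq Eorb eqxx /=.
apply/forall_inP => y; rewrite -Eorb inE => oy.
apply/forall_inP => z _; rewrite (nextE fcyc oy).
apply/eqP; apply/idP/eqP => [yz|->]; last exact/fE/orbC.
exact: funG yz (fE _ (orbC _ oy)).
Qed.

(** Prepending predecessors not yet visited must stop, since a duplicate-free path has at most
    [#|T|] vertices. *)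
Lemma exists_maximal_path (T : finType) (e : rel T) (z : T) :
  exists y s, [/\ path e y s, last y s = z, uniq (y :: s) &
    forall w, e w y -> w \in y :: s].
Proof.
have grow n : exists y s, [/\ path e y s, last y s = z, uniq (y :: s) &
    (forall w, e w y -> w \in y :: s) \/ (n <= size s)%N].
  elim: n => [|n [y [s [pys lz us]]]]; first by exists z, [::]; split=> //; right.
  case=> [maxy|ns]; first by exists y, s; split=> //; left.
  have [w /andP[wy nw]|max] := pickP [pred w | e w y & w \notin y :: s].
    exists w, (y :: s); split=> //=; [by rewrite wy|by rewrite nw|by right].
  exists y, s; split=> //; left=> w wy.
  by apply: contraFT (max w) => /= ->; rewrite wy.
have [y [s [pys lz us]]] := grow #|T|; case=> [maxy|big].
  by exists y, s.
by have := max_card (mem (y :: s)); rewrite (card_uniqP us) /= leqNgt ltnS big.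
Qed.

(** The last vertex of a linear listing has no successor. Conversely, from a vertex [z] without
    successor, a maximal path traced backwards is joined by no edge to an outside vertex, so it
    lists the whole component. *)
Lemma is_linear_component (G : marked_digraph) (x : vertex G) :
  edge_functional G -> edge_injective G ->
  is_linear (component x) = ~~ [forall y in component x, has_out y].
Proof.
move=> funG injG; apply/existsP/forall_inPn => [[v /and3P[uv /eqP/setP Ev]]|].
  have memE y : (y \in component x) = (y \in tval v) by rewrite -Ev inE.
  move/forall_inP=> edgeE; pose z := last x v.
  have vz : z \in tval v.
    by have := mem_component x; rewrite memE /z; case: (tval v) => //= a s; rewrite mem_last.
  have Cz : z \in component x by rewrite memE.
  exists z => //; apply/existsPn => w; apply/negP => zw.
  have Cw := component_out Cz zw.
  have /eqP Ew : index w v == (index z v).+1.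
    by rewrite -(eqP (forall_inP (edgeE z Cz) w Cw)).
  have := Cw; rewrite memE -index_mem Ew /z.
  case: (tval v) uv vz => // a s us _.
  by rewrite -[last x _]/(last a s) index_last // ltnn.
case=> z Cz nz.
have [y [s [pys lz us maxy]]] := @exists_maximal_path _ (@edge G) z.
set v := y :: s in us maxy.
have edge_nth i : (i.+1 < size v)%N -> edge (nth z v i) (nth z v i.+1).
  by move=> lt; have /(pathP z) := pys; apply.
have out_last w : ~~ edge z w.
  by apply: contra nz => zw; apply/existsP; exists w.
have nth_lt i w : (i < size v)%N -> edge (nth z v i) w -> (i.+1 < size v)%N.
  move=> lti iw; rewrite ltn_neqAle lti andbT; apply: contraTneq iw => /= [[->]].
  by rewrite (nth_last z (y :: s)) /= lz out_last.
(* By maximality a predecessor of [y] would lie on the path; its only successor is then the next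
   vertex of the path, which is not the first one. *)
have start w : ~~ edge w y.
  apply/negP => wy; have /(nthP z)[i lti Ew] := maxy w wy.
  rewrite -Ew in wy; have lt := nth_lt _ _ lti wy.
  have := funG _ _ _ wy (edge_nth _ lt) => /eqP.
  by rewrite -[y]/(nth z v 0) nth_uniq.
have closed_v w w' : edge w w' -> (w \in v) = (w' \in v).
  move=> ww'; apply/idP/idP => /(nthP z)[i lti Ei].
    rewrite -Ei in ww'; have lt := nth_lt _ _ lti ww'.
    by rewrite (funG _ _ _ ww' (edge_nth _ lt)) mem_nth.
  case: i => [|i] in lti Ei; first by rewrite -Ei /= (negbTE (start w)) in ww'.
  by rewrite -Ei in ww'; rewrite (injG _ _ _ ww' (edge_nth _ lti)) mem_nth // ltnW.
have zv : z \in v by rewrite -lz mem_last.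
have Ev : [set w in v] = component x.
  apply/eqP; rewrite -(component_eq _ _ Cz) eqEsubset; apply/andP; split.
    apply/subsetP => w; rewrite inE => /(nthP z)[i lti <-].
    have Clast : nth z v (size v).-1 \in component z.
      by rewrite nth_last /= lz mem_component.
    (* Positions are counted back from the end, because membership spreads from [z] against the
       edges. Truncated subtraction makes the induction stall harmlessly at position 0. *)
    rewrite -(subKn (_ : i <= (size v).-1)%N) //.
    elim: ((size v).-1 - i)%N => [|k IH]; first by rewrite subn0.
    have [le|gt] := leqP (size v).-1 k.
      by move: IH; rewrite (eqP le) subnS (eqP le).
    apply: component_in IH _; rewrite -[in X in edge _ X](subnSK gt).
    by apply: edge_nth; move: gt; rewrite /v /=; lia.
  apply/subsetP => w Cw; rewrite inE.
  by apply: (@component_sub G z (fun w => w \in v)) Cw.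
have sz : size v == #|component x| by rewrite -Ev cardsE (card_uniqP us).
exists (Tuple sz); apply/and3P; split; [exact: us|exact/eqP|].
have memE w : (w \in component x) = (w \in v) by rewrite -Ev inE.
apply/forall_inP => w Cw; apply/forall_inP => w' Cw'.
have [vw vw'] : w \in v /\ w' \in v by rewrite -!memE.
rewrite -[X in is_true X]/(edge w w' == (index w' v == (index w v).+1)).
have ltw : (index w v < size v)%N by rewrite index_mem.
apply/eqP; apply/idP/eqP => [ww'|Ei].
  rewrite -(nth_index z vw) in ww'; have lt := nth_lt _ _ ltw ww'.
  by rewrite (funG _ _ _ ww' (edge_nth _ lt)) index_uniq.
rewrite -(nth_index z vw) -(nth_index z vw') Ei; apply: edge_nth.
by rewrite -Ei index_mem.
Qed.

Definition all_out {G : marked_digraph} (C : {set vertex G}) : bool :=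
  [forall x in C, has_out x].

Definition unmarked {G : marked_digraph} (C : {set vertex G}) : bool :=
  [forall x in C, ~~ marked_zero x].

Lemma num_circularE (G : marked_digraph) :
  edge_functional G -> edge_injective G ->
  num_circular G = #|[set C in components G | all_out C]|.
Proof.
move=> funG injG; apply: eq_card => C; rewrite !inE.
apply: andb_id2l; rewrite components_imset => /imsetP[x _ ->].
exact: is_circular_component.
Qed.

Lemma num_free_linearE (G : marked_digraph) :
  edge_functional G -> edge_injective G ->
  num_free_linear G =
    #|[set C in components G | ~~ all_out C && unmarked C]|.
Proof.
move=> funG injG; apply: eq_card => C; rewrite !inE.
apply: andb_id2l; rewrite components_imset => /imsetP[x _ ->].
by rewrite /is_free_linear is_linear_component.
Qed.

(** * Contractions of digraphs and the transfer of component counts *)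

Lemma component_sym {G : marked_digraph} (x y : vertex G) :
  (y \in component x) = (x \in component y).
Proof. by rewrite !inE connect_adjacent_sym. Qed.

Lemma component_adjacent {G : marked_digraph} {x y z : vertex G} :
  y \in component x -> adjacent y z -> z \in component x.
Proof. by rewrite !inE => xy yz; apply: connect_trans xy (connect1 yz). Qed.

(** Taking preimages under [h] is the bijection: by [meet] each counted component of [G] is the
    component of some [h x], and its preimage is then the component of [x]. *)
Lemma card_components_transfer (G H : marked_digraph) (h : vertex H -> vertex G)
    (P : pred {set vertex G}) (Q : pred {set vertex H}) :
  (forall x y, (h y \in component (h x)) = (y \in component x)) ->
  (forall x, P (component (h x)) = Q (component x)) ->
  (forall u, P (component u) -> exists x, h x \in component u) ->
  #|[set C in components G | P C]| = #|[set C in components H | Q C]|.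
Proof.
move=> hcomp PQ meet.
have repr C : C \in [set C in components G | P C] ->
    exists2 x, C = component (h x) & Q (component x).
  rewrite inE components_imset => /andP[/imsetP[u _ ->] Pu].
  have [x Cx] := meet u Pu; exists x; first by rewrite (component_eq _ _ Cx).
  by rewrite -PQ (component_eq _ _ Cx).
have preE x : h @^-1: component (h x) = component x.
  by apply/setP => y; rewrite inE hcomp.
have preI : {in [set C in components G | P C] &,
    injective (fun C : {set vertex G} => h @^-1: C)}.
  move=> _ _ /repr[x -> _] /repr[y -> _]; rewrite !preE => xy.
  by apply: esym; apply: component_eq; rewrite hcomp xy mem_component.
rewrite -(card_in_imset preI); apply: eq_card => D; rewrite inE.
apply/imsetP/andP => [[C /repr[x -> Qx] ->]|[]].
  by rewrite preE components_imset imset_f.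
rewrite components_imset => /imsetP[x _ ->] Qx.
exists (component (h x)); last by rewrite preE.
by rewrite inE PQ components_imset imset_f.
Qed.

(* [H] arises from [G] by suppressing the vertices outside the image of [h]:
   a suppressed vertex is bypassed, and hands its mark on to its neighbours. *)
Record contraction {G H : marked_digraph} (h : vertex H -> vertex G) : Prop :=
  Contraction {
    contraction_inj : injective h;
    contraction_sep :
      forall u v, adjacent u v -> u \notin codom h -> v \in codom h;
    contraction_edge : forall x y, edge x y <->
      edge (h x) (h y) \/
      exists u, [/\ u \notin codom h, edge (h x) u & edge u (h y)];
    contraction_marked : forall x, marked_zero x <->
      marked_zero (h x) \/
      exists u, [/\ u \notin codom h, adjacent (h x) u & marked_zero u];
    contraction_isolated : forall u, u \notin codom h ->
      (forall x, ~~ adjacent u (h x)) -> marked_zero u }.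

Lemma contraction_component {G H : marked_digraph} {h : vertex H -> vertex G} :
  edge_functional G -> edge_injective G -> contraction h ->
  forall x y, (h y \in component (h x)) = (y \in component x).
Proof.
move=> funG injG [hI sep edgeE _ _] x y; apply/idP/idP; last first.
  move: y; apply: (@component_sub H x (fun y => h y \in component (h x))).
    exact: mem_component.
  move=> y z /edgeE[yz|[u [_ yu uz]]]; apply/idP/idP => C.
  - exact: component_out C yz.
  - exact: component_in C yz.
  - exact: component_out (component_out C yu) uz.
  - exact: component_in (component_in C uz) yu.
(* [D] extends membership in the component of [x] to all of [G]: for a retained [u = h y] it says
   that [y] is a member, for a suppressed [u] that all its retained neighbours come from members. *)
pose D u := [forall y, (h y == u) || (u \notin codom h) && adjacent u (h y)
               ==> (y \in component x)].
have adjD u v : adjacent u v -> D u -> D v.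
  move=> uv /forallP Du; apply/forallP => {}y; apply/implyP.
  have [/codomP[w uw]|nu] := boolP (u \in codom h); last first.
    rewrite (sep _ _ uv nu) orbF => /eqP yv.
    by apply: (implyP (Du y)); rewrite nu yv uv orbT.
  have Cw : w \in component x by apply: (implyP (Du w)); rewrite uw eqxx.
  case/orP=> [/eqP yv|/andP[nv vy]].
    rewrite uw -yv in uv; case/orP: uv => E.
      by apply: component_out Cw _; apply/edgeE; left.
    by apply: component_in Cw _; apply/edgeE; left.
  (* Here the suppressed [v] lies between [h w] and [h y]. Edges running through [v] give a bypass
     edge of [H]; edges both entering or both leaving [v] force [y = w]. *)
  rewrite uw in uv; case/orP: uv => E1; case/orP: vy => E2.
  - by apply: component_out Cw _; apply/edgeE; right; exists v.
  - by rewrite (hI _ _ (injG _ _ _ E2 E1)).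
  - by rewrite (hI _ _ (funG _ _ _ E2 E1)).
  - by apply: component_in Cw _; apply/edgeE; right; exists v.
move=> Cy; have /forallP/(_ y) : D (h y); last by rewrite eqxx.
apply: (@component_sub G (h x) D) Cy.
  apply/forallP => w; rewrite codom_f orbF; apply/implyP => /eqP/hI ->.
  exact: mem_component.
move=> u v uv; apply/idP/idP; apply: adjD; rewrite /adjacent /= uv ?orbT //.
Qed.

(** Neighbours of a suppressed vertex are retained, so without a retained neighbour [u] would be
    isolated and could not share a component with [h x]. *)
Lemma contraction_suppressed {G H : marked_digraph} {h : vertex H -> vertex G}
    (x : vertex H) (u : vertex G) :
  contraction h -> u \in component (h x) -> u \notin codom h ->
  exists2 y, adjacent u (h y) & h y \in component (h x).
Proof.
move=> [_ sep _ _ _] Cu nu.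
have [y uy|iso] := pickP [pred y | adjacent u (h y)].
  by exists y => //; apply: component_adjacent Cu uy.
have nadj v : ~~ adjacent u v.
  apply/negP => uv; have /codomP[y vy] := sep _ _ uv nu.
  by have := iso y; rewrite /= -vy => /negP.
have /eqP xu : h x == u.
  move: Cu; rewrite component_sym.
  apply: (@component_sub G u (pred1 u)) => [|v w vw] /=; first exact: eqxx.
  apply/idP/idP => /eqP E; rewrite E in vw.
    by case/negP: (nadj w); rewrite /adjacent /= vw.
  by case/negP: (nadj v); rewrite /adjacent /= vw orbT.
by rewrite -xu codom_f in nu.
Qed.

(** This holds for whole components, not vertex by vertex: [h y] may lead to a suppressed vertex
    without successor, and then [y] has no successor in [H]. *)
Lemma contraction_all_out {G H : marked_digraph} {h : vertex H -> vertex G}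
    (x : vertex H) :
  edge_functional G -> edge_injective G -> contraction h ->
  all_out (component (h x)) = all_out (component x).
Proof.
move=> funG injG ctr; have compE := contraction_component funG injG ctr.
have [hI sep edgeE _ _] := ctr.
apply/forall_inP/forall_inP => [out y Cy|out u Cu].
  have /existsP[v yv] : has_out (h y) by rewrite out // compE.
  have Cv : v \in component (h x) by apply: component_out yv; rewrite compE.
  have [/codomP[w vw]|nv] := boolP (v \in codom h).
    by apply/existsP; exists w; apply/edgeE; left; rewrite -vw.
  have /existsP[t vt] := out v Cv.
  have /codomP[w tw] : t \in codom h.
    by apply: sep nv; rewrite /adjacent /= vt.
  by apply/existsP; exists w; apply/edgeE; right; exists v; rewrite -tw.
have [/codomP[y uy]|nu] := boolP (u \in codom h).
  have /out/existsP[w /edgeE] : y \in component x by rewrite -compE -uy.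
  rewrite -uy => -[uw|[v [_ uv _]]]; apply/existsP; first by exists (h w).
  by exists v.
have [y uy Cy] := contraction_suppressed x u ctr Cu nu.
case/orP: uy => [uy|yu]; apply/existsP; first by exists (h y).
(* The edge of [H] out of [y] cannot come from a direct edge, as the only successor of [h y] is the
   suppressed [u]; so it bypasses [u], which therefore has a successor. *)
have /out/existsP[w /edgeE[yw|[v [_ yv vw]]]] : y \in component x.
- by rewrite -compE.
- by rewrite (funG _ _ _ yu yw) codom_f in nu.
- by exists (h w); rewrite (funG _ _ _ yu yv).
Qed.

(** A marked suppressed vertex has a retained neighbour in the component, and that neighbour carries
    the mark in [H]. *)
Lemma contraction_unmarked {G H : marked_digraph} {h : vertex H -> vertex G}
    (x : vertex H) :
  edge_functional G -> edge_injective G -> contraction h ->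
  unmarked (component (h x)) = unmarked (component x).
Proof.
move=> funG injG ctr; have compE := contraction_component funG injG ctr.
have [_ _ _ markE _] := ctr.
apply/forall_inP/forall_inP => [unm y Cy|unm u Cu].
  have Chy : h y \in component (h x) by rewrite compE.
  apply/negP => /markE[]; first exact/negP/unm.
  by case=> u [_ yu]; apply/negP/unm; apply: component_adjacent Chy yu.
have [/codomP[y uy]|nu] := boolP (u \in codom h).
  rewrite uy; apply: contra (unm y _); last by rewrite -compE -uy.
  by move=> my; apply/markE; left.
have [y uy Cy] := contraction_suppressed x u ctr Cu nu.
apply: contra (unm y _) => [mu|]; last by rewrite -compE.
by apply/markE; right; exists u; split=> //; rewrite /adjacent /= orbC.
Qed.

(** A component of [G] missed by [h] contains a suppressed vertex without neighbours, which has no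
    successor and is marked. Such a component is neither circular nor free, so it enters neither
    count. *)
Lemma contraction_counts {G H : marked_digraph} {h : vertex H -> vertex G} :
  edge_functional G -> edge_injective G ->
  edge_functional H -> edge_injective H -> contraction h ->
  num_circular G = num_circular H /\ num_free_linear G = num_free_linear H.
Proof.
move=> funG injG funH injH ctr.
have compE := contraction_component funG injG ctr.
have outE x := contraction_all_out x funG injG ctr.
have unmE x := contraction_unmarked x funG injG ctr.
have meet u : (exists x, h x \in component u) \/
    ~~ all_out (component u) && ~~ unmarked (component u).
  have [/codomP[x ux]|nu] := boolP (u \in codom h).
    by left; exists x; rewrite -ux mem_component.
  have [x ux|iso] := pickP [pred x | adjacent u (h x)].
    by left; exists x; apply: component_adjacent (mem_component u) ux.
  right; apply/andP; split; apply/forall_inPn; exists u.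
  - exact: mem_component.
  - apply/existsPn => v; apply/negP => uv.
    have adj : adjacent u v by rewrite /adjacent /= uv.
    have /codomP[x vx] := contraction_sep _ ctr _ _ adj nu.
    by have := iso x; rewrite /= -vx; case/negP.
  - exact: mem_component.
  - rewrite negbK; apply: contraction_isolated ctr _ nu _ => x.
    by have := iso x; rewrite /= => ->.
split.
  rewrite !num_circularE //; apply: (card_components_transfer _ _ h) => // u Pu.
  by case: (meet u) => //; rewrite Pu.
rewrite !num_free_linearE //; apply: (card_components_transfer _ _ h) => //.
  by move=> x; rewrite outE unmE.
by move=> u /andP[_ Pu]; case: (meet u) => //; rewrite Pu andbF.
Qed.

(** * The digraph of the uniform rule, with edges and marks as linear constraints *)

(* The rule for [s >= 2], applied to sequences of any length. *)
Definition gamma_uniform (m : nat) (eps : seq int) : marked_digraph :=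
  @MarkedDigraph ('I_m * 'I_(size eps))%type
    (fun x y => (y.2 == ordS x.2) &&
      [exists j : 'I_m,
        [&& Num.max (gammaA x.2) (gammaB x.2) <= j%:Z,
            x.1%:Z == j%:Z - gammaA x.2 & y.1%:Z == j%:Z - gammaB x.2]])
    (fun x _ => gammaA x.2 - gammaB x.2)
    (fun x => [exists t : 'I_(size eps), exists j : 'I_m,
      [&& gammaA t <= j%:Z, j%:Z < gammaB t, x.2 == t
        & x.1%:Z == j%:Z - gammaA t]
      || [&& gammaB t <= j%:Z, j%:Z < gammaA t, x.2 == ordS t
           & x.1%:Z == j%:Z - gammaB t]]).

Arguments edge : simpl never.
Arguments marked_zero : simpl never.

Lemma gammaA_ge0 (eps : seq int) (t : 'I_(size eps)) : 0 <= gammaA t.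
Proof. by rewrite /gammaA le_max lexx orbT. Qed.

Lemma gammaB_ge0 (eps : seq int) (t : 'I_(size eps)) : 0 <= gammaB t.
Proof. by rewrite /gammaB le_max lexx orbT. Qed.

Lemma ord_of_int {m : nat} {z : int} :
  0 <= z -> z < m%:Z -> exists j : 'I_m, j%:Z = z.
Proof. by case: z => // n _ ltn; exists (Ordinal (ltn : (n < m)%N)). Qed.

(** The index [j] is eliminated as the common value of both sides of the equation. Its lower bound
    holds because levels are nonnegative, so only [j < m] remains. *)
Lemma gamma_uniform_edgeP (m : nat) (eps : seq int)
    (x y : vertex (gamma_uniform m eps)) :
  edge x y <-> [/\ y.2 = ordS x.2,
    x.1%:Z + gammaA x.2 = y.1%:Z + gammaB x.2 & x.1%:Z + gammaA x.2 < m%:Z].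
Proof.
have A0 := gammaA_ge0 _ x.2; have B0 := gammaB_ge0 _ x.2.
split=> [/andP[/eqP yx /existsP[j /and3P[_ /eqP xj /eqP yj]]]|[yx xy ltm]].
  by have := ltn_ord j; split=> //; lia.
have [||j jE] := @ord_of_int m (x.1%:Z + gammaA x.2); [lia|lia|].
apply/andP; split; first exact/eqP.
by apply/existsP; exists j; rewrite jE ge_max; apply/and3P; split; lia.
Qed.

(** The first alternative is a mark from the step leaving the column of [x], the second a mark from
    the step entering it; [j] is eliminated as for edges. *)
Lemma gamma_uniform_markedP (m : nat) (eps : seq int)
    (x : vertex (gamma_uniform m eps)) :
  marked_zero x <->
    (x.1%:Z + gammaA x.2 < gammaB x.2 /\ x.1%:Z + gammaA x.2 < m%:Z) \/
    exists t, [/\ x.2 = ordS t, x.1%:Z + gammaB t < gammaA t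
      & x.1%:Z + gammaB t < m%:Z].
Proof.
split=> [/existsP[t /existsP[j /orP[]/and4P[le lt /eqP xt /eqP xj]]]|].
- by have := ltn_ord j; left; rewrite xt; lia.
- by have := ltn_ord j; right; exists t; split=> //; lia.
have A0 := gammaA_ge0 eps; have B0 := gammaB_ge0 eps.
case=> [[lt ltm]|[t [xt lt ltm]]]; apply/existsP.
  have [||j jE] := @ord_of_int m (x.1%:Z + gammaA x.2); [|by []|].
    by have := A0 x.2; lia.
  exists x.2; apply/existsP; exists j; apply/orP; left.
  by rewrite jE; apply/and4P; split=> //; lia.
have [||j jE] := @ord_of_int m (x.1%:Z + gammaB t); [|by []|].
  by have := B0 t; lia.
exists t; apply/existsP; exists j; apply/orP; right.
by rewrite jE xt; apply/and4P; split=> //; lia.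
Qed.

Lemma gamma_uniform_functional (m : nat) (eps : seq int) :
  edge_functional (gamma_uniform m eps).
Proof.
move=> x y z /gamma_uniform_edgeP[yx xy _] /gamma_uniform_edgeP[zx xz _].
have E1 : y.1 = z.1 by apply: ord_inj; lia.
by rewrite (surjective_pairing y) E1 yx -zx -surjective_pairing.
Qed.

Lemma gamma_uniform_injective (m : nat) (eps : seq int) :
  edge_injective (gamma_uniform m eps).
Proof.
move=> x y z /gamma_uniform_edgeP[zx xz _] /gamma_uniform_edgeP[zy yz _].
have E2 : x.2 = y.2 by apply: ordS_inj; rewrite -zx.
rewrite E2 in xz; have E1 : x.1 = y.1 by apply: ord_inj; lia.
by rewrite (surjective_pairing x) E1 E2 -surjective_pairing.
Qed.

Lemma val_ordS (n : nat) (t : 'I_n) :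
  ordS t = (if t.+1 == n then 0 else t.+1)%N :> nat.
Proof.
rewrite /=; case: eqP => [->|ne]; first exact: modnn.
by rewrite modn_small //; have := ltn_ord t; lia.
Qed.

(** * Deletion of one zero entry from a circular sequence *)

Section RemoveZero.
Variables (s1 s2 : seq int).
Hypothesis nonempty : (0 < size (s1 ++ s2))%N.
Local Notation eps := (s1 ++ @cons int 0 s2).
Local Notation eps' := (s1 ++ s2).

Lemma skip_subproof (t : 'I_(size eps')) : (bump (size s1) t < size eps)%N.
Proof.
move: (nat_of_ord t) (ltn_ord t) => k.
by rewrite /bump !size_cat /=; case: leqP => /=; lia.
Qed.

Definition skip_zero (t : 'I_(size eps')) : 'I_(size eps) :=
  Ordinal (skip_subproof t).

Lemma zero_position_subproof : (size s1 < size eps)%N.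
Proof. by rewrite size_cat /=; lia. Qed.

Definition zero_position : 'I_(size eps) := Ordinal zero_position_subproof.

Lemma skip_zero_inj : injective skip_zero.
Proof. by move=> t u /(congr1 val)/(can_inj (bumpK _))/val_inj. Qed.

Lemma skip_zero_neq (t : 'I_(size eps')) : skip_zero t <> zero_position.
Proof. by move/(congr1 val)/eqP; rewrite /= eq_sym (negbTE (neq_bump _ _)). Qed.

Lemma skip_zeroP (t : 'I_(size eps)) :
  t = zero_position \/ exists u, t = skip_zero u.
Proof.
have [E|ne] := eqVneq (t : nat) (size s1); first by left; apply: val_inj.
right.
have lt : (unbump (size s1) t < size eps')%N.
  move: (nat_of_ord t) (ltn_ord t) ne => k.
  by rewrite /unbump !size_cat /=; case: ltnP => /=; lia.
by exists (Ordinal lt); apply: val_inj; rewrite /= unbumpK // inE eq_sym.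
Qed.

Lemma nth_skip_zero (t : 'I_(size eps')) : eps`_(skip_zero t) = eps'`_t.
Proof.
rewrite /= !nth_cat /bump; case: (leqP (size s1) t) => le.
  by rewrite [(true + t)%N]add1n ltnNge (leqW le) subSn.
by rewrite [(false + t)%N]add0n le.
Qed.

Lemma nth_zero_position : eps`_zero_position = 0.
Proof. by rewrite nth_cat ltnn subnn. Qed.

(** By [nonempty] the sequence has at least two entries, so the cyclic successor has no fixed point.
    This keeps suppressed vertices from being adjacent to each other. *)
Lemma ordS_zero_position : ordS zero_position <> zero_position.
Proof.
move/(congr1 val); rewrite [X in X = _]val_ordS /= size_cat /=.
by move: nonempty; rewrite size_cat; case: eqP; lia.
Qed.

(** Deleting a position preserves the cyclic order of the others: the successor is unchanged unless
    the deleted position lies just after [t]. *)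
Lemma ordS_skip_zero (t : 'I_(size eps')) :
  ordS (skip_zero t) = skip_zero (ordS t) \/
  ordS (skip_zero t) = zero_position /\
    ordS zero_position = skip_zero (ordS t).
Proof.
have valE : skip_zero (ordS t) =
    bump (size s1) (if t.+1 == size eps' then 0 else t.+1) :> nat.
  by rewrite -val_ordS.
have [E|ne] := eqVneq (ordS (skip_zero t)) zero_position; [right|left].
  split=> //; apply: ord_inj; move/(congr1 (@nat_of_ord _)): E.
  rewrite valE !val_ordS /=.
  move: (nat_of_ord t) (ltn_ord t) nonempty => k; rewrite /bump !size_cat /=.
  by do ![case: eqP => ? /=|case: leqP => ? /=]; lia.
apply: ord_inj; move: ne; rewrite -(inj_eq (@ord_inj _)) => /eqP.
rewrite valE !val_ordS /=.
move: (nat_of_ord t) (ltn_ord t) nonempty => k; rewrite /bump !size_cat /=.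
by do ![case: eqP => ? /=|case: leqP => ? /=]; lia.
Qed.

Lemma gammaA_skip_zero (t : 'I_(size eps')) : gammaA (skip_zero t) = gammaA t.
Proof. by rewrite /gammaA nth_skip_zero. Qed.

Lemma gammaA_zero_position : gammaA zero_position = 0.
Proof. by rewrite /gammaA nth_zero_position maxxx. Qed.

(** [gammaB] reads only the entry at the next position. The statement thus also covers
    [t = zero_position], whose [gammaB] equals that of its predecessor after the deletion. *)
Lemma gammaB_eq (t : 'I_(size eps)) (u : 'I_(size eps')) :
  ordS t = skip_zero (ordS u) -> gammaB t = gammaB u.
Proof. by rewrite /gammaB => ->; rewrite nth_skip_zero. Qed.

Lemma gammaB_before_zero (t : 'I_(size eps)) :
  ordS t = zero_position -> gammaB t = 0.
Proof. by rewrite /gammaB => ->; rewrite nth_zero_position oppr0 maxxx. Qed.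

Definition skip_zero_vertex (m : nat) (x : vertex (gamma_uniform m eps')) :
  vertex (gamma_uniform m eps) := (x.1, skip_zero x.2).

Lemma skip_zero_vertex_inj (m : nat) : injective (@skip_zero_vertex m).
Proof.
move=> [i t] [j u] E; congr pair; first exact: (congr1 fst E).
exact: skip_zero_inj (congr1 snd E).
Qed.

Lemma codom_skip_zero_vertex (m : nat) (u : vertex (gamma_uniform m eps)) :
  reflect (u.2 = zero_position) (u \notin codom (@skip_zero_vertex m)).
Proof.
apply: (iffP idP) => [nu|u0].
  have [//|[t ut]] := skip_zeroP u.2; case/codomP: nu.
  by exists (u.1, t); rewrite /skip_zero_vertex -ut -surjective_pairing.
by apply/codomP => -[x xu]; apply: (@skip_zero_neq x.2); rewrite -u0 xu.
Qed.

Lemma before_zero_position :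
  exists t, ordS (skip_zero t) = zero_position.
Proof.
have [E|[t E]] := skip_zeroP (ord_pred zero_position).
  by case: ordS_zero_position; rewrite -{1}E ord_predK.
by exists t; rewrite -E ord_predK.
Qed.

Lemma skip_zero_contraction (m : nat) : contraction (@skip_zero_vertex m).
Proof.
split.
- exact: skip_zero_vertex_inj.
- move=> u v uv /codom_skip_zero_vertex u0.
  apply/negPn/negP => /codom_skip_zero_vertex v0; case: ordS_zero_position.
  case/orP: uv => /gamma_uniform_edgeP[E _ _].
    by rewrite -{1}u0 -E.
  by rewrite -{1}v0 -E.
- move=> x y; rewrite !gamma_uniform_edgeP /= gammaA_skip_zero.
  have [S1|[S1 S2]] := ordS_skip_zero x.2.
    rewrite S1 (gammaB_eq _ _ S1); split=> [[-> xy ltm]|]; first by left.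
    case=> [[/skip_zero_inj-> xy ltm] //|[u [/codom_skip_zero_vertex u0]]].
    by case/gamma_uniform_edgeP=> /=; rewrite u0 S1 => /esym/skip_zero_neq.
  have B0 := gammaB_before_zero _ S1; have BE := gammaB_eq _ _ S2.
  split=> [[yx xy ltm]|].
    (* The bypassed vertex sits at the index [j] of the edge itself: the step into the zero column
       has [gammaB = 0] and the step out of it has [gammaA = 0]. *)
    have [||j jE] := @ord_of_int m (x.1%:Z + gammaA x.2); [|by []|].
      by have := gammaA_ge0 _ x.2; lia.
    right; exists (j, zero_position); split; first exact/codom_skip_zero_vertex.
      by apply/gamma_uniform_edgeP; rewrite /= S1 gammaA_skip_zero B0 jE addr0.
    apply/gamma_uniform_edgeP.
    by rewrite /= yx S2 gammaA_zero_position BE addr0 jE.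
  rewrite S1 => -[[/skip_zero_neq //]|[u [/codom_skip_zero_vertex u0]]].
  case/gamma_uniform_edgeP=> /= _; rewrite gammaA_skip_zero B0 => E1 ltm.
  case/gamma_uniform_edgeP=> /=; rewrite u0 S2 gammaA_zero_position BE.
  by move=> /skip_zero_inj-> E2 _; split=> //; exact: etrans E1 E2.
- move=> [i r]; rewrite !gamma_uniform_markedP /= gammaA_skip_zero; split.
    case=> [[lt ltm]|[t [-> lt ltm]]].
      have [S1|[S1 S2]] := ordS_skip_zero r.
        by left; left; rewrite (gammaB_eq _ _ S1).
      (* A mark from the leaving step becomes, in the longer sequence, a mark at level [j] of the
         zero column, which the vertex reaches by an edge. The case of an entering step below is its
         mirror image. *)
      have [||j jE] := @ord_of_int m (i%:Z + gammaA r); [|by []|].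
        by have := gammaA_ge0 _ r; lia.
      right; exists (j, zero_position); split; first exact/codom_skip_zero_vertex.
        apply/orP; left; apply/gamma_uniform_edgeP.
        by rewrite /= S1 gammaA_skip_zero (gammaB_before_zero _ S1) jE addr0.
      apply/gamma_uniform_markedP; left.
      by rewrite /= gammaA_zero_position (gammaB_eq _ _ S2) addr0 jE.
    have [S1|[S1 S2]] := ordS_skip_zero t.
      left; right; exists (skip_zero t).
      by rewrite S1 (gammaB_eq _ _ S1) gammaA_skip_zero.
    have [||j jE] := @ord_of_int m (i%:Z + gammaB t); [|by []|].
      by have := gammaB_ge0 _ t; lia.
    right; exists (j, zero_position); split; first exact/codom_skip_zero_vertex.
      apply/orP; right; apply/gamma_uniform_edgeP.
      by rewrite /= S2 gammaA_zero_position (gammaB_eq _ _ S2) jE addr0.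
    apply/gamma_uniform_markedP; right; exists (skip_zero t).
    by rewrite /= S1 gammaA_skip_zero (gammaB_before_zero _ S1) addr0 jE.
  case=> [[[lt ltm]|[t [rt lt ltm]]]|[[k z] [/codom_skip_zero_vertex/= ->]]].
  + have [S1|[S1 S2]] := ordS_skip_zero r.
      by left; rewrite -(gammaB_eq _ _ S1).
    have := gammaA_ge0 _ r; rewrite (gammaB_before_zero _ S1) in lt; lia.
  + have [Et|[v Et]] := skip_zeroP t; rewrite {}Et in rt lt ltm.
      have := gammaB_ge0 _ zero_position.
      by rewrite gammaA_zero_position in lt; lia.
    have [S1|[S1 S2]] := ordS_skip_zero v; last first.
      by rewrite S1 in rt; case: (skip_zero_neq _ rt).
    rewrite (gammaB_eq _ _ S1) gammaA_skip_zero in lt ltm.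
    by right; exists v; rewrite S1 in rt; split=> //; apply: skip_zero_inj.
  + have lti := ltn_ord i; have ltk := ltn_ord k => adj.
    move/gamma_uniform_markedP; rewrite /= gammaA_zero_position.
    (* If the edge enters [(k, z)], then [k = i + gammaA r] rules out a mark from the entering step;
       if it leaves, [k = i + gammaB] rules out one from the leaving step. The remaining mark passes
       to the neighbour. *)
    case/orP: adj => /gamma_uniform_edgeP[/=].
      rewrite gammaA_skip_zero => S1 E1 _.
      have [S1'|[_ S2]] := ordS_skip_zero r.
        by rewrite S1' in S1; case: (skip_zero_neq _ (esym S1)).
      rewrite (gammaB_before_zero _ (esym S1)) in E1.
      case=> [[lt _]|[t [tS lt _]]].
        by rewrite (gammaB_eq _ _ S2) in lt; left; split; lia.
      have tE : t = skip_zero r by apply: ordS_inj; rewrite -tS.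
      by move: lt; rewrite tE gammaA_skip_zero gammaB_before_zero //; lia.
    rewrite gammaA_zero_position => S0 E1 _ [[lt _]|[t [tS lt _]]]; first by lia.
    have [Et|[v Et]] := skip_zeroP t.
      by case: ordS_zero_position; rewrite -{1}Et.
    rewrite {}Et in tS lt.
    have [S1|[_ S2]] := ordS_skip_zero v.
      by rewrite S1 in tS; case: (skip_zero_neq _ (esym tS)).
    right; exists v.
    rewrite gammaA_skip_zero (gammaB_before_zero _ (esym tS)) in lt.
    rewrite (gammaB_eq _ _ S2) in E1; rewrite S2 in S0.
    by split; [apply: skip_zero_inj|lia|lia].
- move=> [k z] /codom_skip_zero_vertex/= -> iso.
  apply/gamma_uniform_markedP; right=> /=.
  have [t tS] := before_zero_position; exists (skip_zero t).
  rewrite tS gammaA_skip_zero gammaB_before_zero // addr0.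
  (* If [k] were at least [gammaA t], the vertex at level [k - gammaA t] of the preceding column
     would have an edge to this one, against isolation. *)
  have ltk := ltn_ord k; split=> //; rewrite ltNge; apply/negP => le.
  have [||j jE] := @ord_of_int m (k%:Z - gammaA t); [lia| |].
    by have := gammaA_ge0 _ t; lia.
  case/negP: (iso (j, t)); apply/orP; right; apply/gamma_uniform_edgeP.
  rewrite /= tS gammaA_skip_zero gammaB_before_zero // jE.
  by split=> //; lia.
Qed.

Lemma gamma_uniform_remove_zero (m : nat) :
  num_circular (gamma_uniform m eps) = num_circular (gamma_uniform m eps') /\
  num_free_linear (gamma_uniform m eps) =
    num_free_linear (gamma_uniform m eps').
Proof.
by apply: contraction_counts (skip_zero_contraction m);
  (exact: gamma_uniform_functional || exact: gamma_uniform_injective).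
Qed.

End RemoveZero.

(** * Single-entry sequences and the removal of all zeros *)

Lemma no_components (G : marked_digraph) (P : pred {set vertex G}) :
  (forall x, ~~ P (component x)) -> #|[set C in components G | P C]| = 0%N.
Proof.
move=> nP; apply: eq_card0 => C; rewrite inE components_imset.
by apply/negP => /andP[/imsetP[x _ ->]]; apply/negP.
Qed.

Lemma Gamma_uniform (m : nat) (eps : seq int) :
  size eps != 1%N -> Gamma m eps = gamma_uniform m eps.
Proof.
by move=> /negbTE s1; rewrite /Gamma /gamma_edge /gamma_weight /gamma_zero s1.
Qed.

Lemma Gamma_singleton_counts (m : nat) (a : int) : a != 0 ->
  num_circular (Gamma m [:: a]) = 0%N /\
  num_free_linear (Gamma m [:: a]) = 0%N.
Proof.
move=> a0.
have noedge (x y : vertex (Gamma m [:: a])) : ~~ edge x y.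
  by rewrite /edge /= /gamma_edge /= (negbTE a0).
have funG : edge_functional (Gamma m [:: a]).
  by move=> x y z xy; case/negP: (noedge x y).
have injG : edge_injective (Gamma m [:: a]).
  by move=> x y z xz; case/negP: (noedge x z).
rewrite num_circularE // num_free_linearE //.
split; apply: no_components => x.
  apply/forall_inPn; exists x; first exact: mem_component.
  by apply/existsPn => y; apply: noedge.
rewrite negb_and; apply/orP; right.
apply/forall_inPn; exists x; first exact: mem_component.
by rewrite /marked_zero /= /gamma_zero /= negbK.
Qed.

Lemma gammaA_singleton (a : int) (t : 'I_(size [:: a])) :
  gammaA t = Num.max a 0.
Proof. by rewrite (ord1 t). Qed.

Lemma gammaB_singleton (a : int) (t : 'I_(size [:: a])) :
  gammaB t = Num.max (- a) 0.
Proof. by rewrite /gammaB (ord1 (ordS t)). Qed.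

(* Every edge raises the level by [a], so a lowest or highest vertex of a
   component has no successor, and a lowest one is marked. *)
Lemma gamma_uniform_singleton_counts (m : nat) (a : int) : a != 0 ->
  num_circular (gamma_uniform m [:: a]) = 0%N /\
  num_free_linear (gamma_uniform m [:: a]) = 0%N.
Proof.
move=> a0; set G := gamma_uniform m [:: a].
have edgeP (i j : 'I_m) (r t : 'I_1) : @edge G (i, r) (j, t) <->
    i%:Z + a = j%:Z.
  split=> [/gamma_uniform_edgeP[_ /=]|ij].
    by rewrite gammaA_singleton gammaB_singleton; lia.
  have := ltn_ord i; have := ltn_ord j => ltj lti.
  apply/gamma_uniform_edgeP; split; first by rewrite (ord1 (ordS _)) (ord1 _).
    by rewrite /= gammaA_singleton gammaB_singleton; lia.
  by rewrite /= gammaA_singleton; lia.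
(* The mark comes from the entering step if [a] is positive and from the leaving step if it is
   negative. *)
have markP (i : 'I_m) (r : 'I_1) : i%:Z < `|a| -> @marked_zero G (i, r).
  have lti := ltn_ord i => ia; apply/gamma_uniform_markedP.
  have [a_pos|a_neg] := leP 0 a; [right; exists r|left]; rewrite /=.
    rewrite gammaA_singleton gammaB_singleton.
    by split; [rewrite (ord1 (ordS _)) (ord1 _)|lia|lia].
  by rewrite gammaA_singleton gammaB_singleton; lia.
rewrite num_circularE ?num_free_linearE;
  try exact: gamma_uniform_functional; try exact: gamma_uniform_injective.
split; apply: no_components => u.
  apply/negP => /forall_inP out.
  have [a_pos|a_neg] := leP 0 a.
    have [[i r] Cy maxy] :=
      @arg_maxnP _ u (mem (component u)) (fun x => nat_of_ord x.1)
        (mem_component u).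
    have /existsP[[j t] yz] := out _ Cy.
    have /= := maxy _ (component_out Cy yz); move/edgeP: yz; lia.
  have [[i r] Cy miny] :=
    @arg_minnP _ u (mem (component u)) (fun x => nat_of_ord x.1)
      (mem_component u).
  have /existsP[[j t] yz] := out _ Cy.
  have /= := miny _ (component_out Cy yz); move/edgeP: yz; lia.
rewrite negb_and; apply/orP; right; apply/negP => /forall_inP unm.
have [[i r] Cy miny] :=
  @arg_minnP _ u (mem (component u)) (fun x => nat_of_ord x.1)
    (mem_component u).
have lti := ltn_ord i.
have [ia|ia] := ltP i%:Z `|a|; first by case/negP: (unm _ Cy); apply: markP.
(* The vertex [|a|] levels lower is joined to this one by an edge whose direction depends on the
   sign of [a]; it contradicts minimality of the level. *)
have [||j jE] := @ord_of_int m (i%:Z - `|a|); [lia|lia|].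
have Cz : (j, r) \in component u.
  have [a_pos|a_neg] := leP 0 a.
    by apply: component_in Cy _; apply/edgeP; lia.
  by apply: component_out Cy _; apply/edgeP; lia.
by have /= := miny _ Cz; lia.
Qed.

(** The two rules differ only for a single entry, here nonzero, and then all counts vanish. *)
Lemma Gamma_counts (m : nat) (eps : seq int) :
  (exists2 a : int, a \in eps & a != 0) ->
  num_circular (Gamma m eps) = num_circular (gamma_uniform m eps) /\
  num_free_linear (Gamma m eps) = num_free_linear (gamma_uniform m eps).
Proof.
have [|ne1] := eqVneq (size eps) 1%N; last by rewrite Gamma_uniform.
case: eps => [|b []] // _ [a]; rewrite inE => /eqP-> b0.
have [-> ->] := @Gamma_singleton_counts m b b0.
by have [-> ->] := @gamma_uniform_singleton_counts m b b0.
Qed.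

(** The prefix [s1] accumulates the entries already kept. The nonzero entry survives every deletion,
    so the sequence left is never empty. *)
Lemma gamma_uniform_filter (m : nat) (s1 s2 : seq int) :
  (exists2 a : int, a \in s1 ++ s2 & a != 0) ->
  let eps' := s1 ++ [seq a <- s2 | a != 0] in
  num_circular (gamma_uniform m (s1 ++ s2)) =
    num_circular (gamma_uniform m eps') /\
  num_free_linear (gamma_uniform m (s1 ++ s2)) =
    num_free_linear (gamma_uniform m eps').
Proof.
elim: s2 s1 => [|b s2 IH] s1 // [a a_in a0] /=.
have [b0|b0] := eqVneq b 0; last first.
  by rewrite -!cat_rcons; apply: IH; exists a; rewrite ?cat_rcons.
have a_in' : a \in s1 ++ s2.
  by move: a_in; rewrite b0 !mem_cat inE (negbTE a0).
rewrite b0.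
have [|-> ->] := @gamma_uniform_remove_zero s1 s2 _ m.
  by case: (s1 ++ s2) a_in'.
by apply: IH; exists a.
Qed.

Theorem theorem3p11 (m : nat) (eps : seq int) (hm : (1 <= m)%N)
    (heps : exists2 a : int, a \in eps & a != 0) :
  let eps' := [seq a <- eps | a != 0] in
  num_circular (Gamma m eps) = num_circular (Gamma m eps') /\
  num_free_linear (Gamma m eps) = num_free_linear (Gamma m eps').
Proof.
have [a a_in a0] := heps.
have heps' : exists2 a : int, a \in [seq a <- eps | a != 0] & a != 0.
  by exists a; rewrite ?mem_filter ?a0.
(* Both sides pass to the uniform rule first, because the filtered sequence may have length 1 even
   when [eps] does not. *)
move=> eps'; have [-> ->] := Gamma_counts m eps heps.
have [-> ->] := Gamma_counts m eps' heps'.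
exact: (@gamma_uniform_filter m [::] eps).
Qed.
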